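(* Let $A$ be an integral domain and $E$ a finitely generated quasi second $A$-module. Then $\operatorname{ann}(aE)$ is a maximal ideal of $A$ for every $a\in W(E)^{\#}$.
   Context: For an $A$-module $M$: $\operatorname{ann}(M)=\{a\in A: aM=0\}$, $W(M)=\{a\in A: aM\neq M\}$, $W(M)^{\#}=W(M)\setminus\operatorname{ann}(M)$. $E$ is a quasi second module if for all $a,b\in A$, $0\neq bE\subseteq aE\neq E$ implies $bE=aE$. *)

(* Defs.v *)
From mathcomp Require Import all_boot all_algebra.
From mathcomp Require Import boolp classical_sets.

Set Implicit Arguments.
Unset Strict Implicit.
Unset Printing Implicit Defensive.

Import GRing.Theory.
Local Open Scope classical_set_scope.
Local Open Scope ring_scope.

(* Submodules of E are given as subsets [set E]; the module E itself is the
   full set [[set: E]]. *)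

Definition scale_set (A : comNzRingType) (E : lmodType A) (a : A) (M : set E) :
    set E :=
  [set a *: x | x in M].

Definition ann (A : comNzRingType) (E : lmodType A) (M : set E) : set A :=
  [set a | scale_set a M = [set 0]].

Definition W (A : comNzRingType) (E : lmodType A) (M : set E) : set A :=
  [set a | scale_set a M <> M].

Definition Wsharp (A : comNzRingType) (E : lmodType A) (M : set E) : set A :=
  W M `\` ann M.

Definition quasi_second (A : comNzRingType) (E : lmodType A) : Prop :=
  forall a b : A,
    scale_set b [set: E] <> [set 0] ->
    scale_set b [set: E] `<=` scale_set a [set: E] ->
    scale_set a [set: E] <> [set: E] ->
    scale_set b [set: E] = scale_set a [set: E].

Definition finitely_generated (A : comNzRingType) (E : lmodType A) : Prop :=
  exists (n : nat) (e : 'I_n -> E),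
    forall x : E, exists c : 'I_n -> A, x = \sum_(i < n) c i *: e i.

(* [idealr_closed] already requires the ideal to be proper ([1 \notin I]). *)
Definition maximal_ideal (A : comNzRingType) (I : set A) : Prop :=
  idealr_closed [in I] /\
  forall J : set A, idealr_closed [in J] -> I `<=` J -> J = I.

(* Main.v *)
Require Import Defs.
From mathcomp Require Import all_boot all_algebra.
From mathcomp Require Import boolp classical_sets.

(** Since [b(aE)] is contained in [aE], and [aE] differs from [E], the quasi
    second property applied to the pair [(a, ba)] says that [b(aE)] is either
    [0] or [aE]: the module [aE] is second.  It is also finitely generated,
    hence Nakayama's lemma applies to it: as soon as [b(aE) = aE], some
    [1 - b * d] annihilates [aE] ([determinant_trick]).  Thus every [b] outside
    [ann(aE)] is invertible modulo [ann(aE)], so that an ideal containing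
    [ann(aE)] and such a [b] contains [1].  Finally [ann(aE)] is proper because
    [aE] is nonzero. *)

Import GRing.Theory.
Local Open Scope classical_set_scope.
Local Open Scope ring_scope.

(** Evaluating the polynomial [det (1 - 'X C)] at [0] gives [1], so its value
    at [b] is [1] modulo [b]. *)
Lemma det_sub1_scale {A : comNzRingType} {n : nat} (b : A) (C : 'M[A]_n) :
  exists d, \det (1%:M - b *: C) = 1 - b * d.
Proof.
pose q : {poly A} := \det (1%:M - 'X *: map_mx polyC C).
have q_eval x : q.[x] = \det (1%:M - x *: C).
  rewrite -[q.[x]]/(horner_eval x q) -det_map_mx; congr (\det _).
  apply/matrixP=> i j; rewrite !mxE /= /horner_eval !hornerE.
  by rewrite hornerMn hornerC.
have /factor_theorem[r q_fact] : root (q - 1) 0.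
  by rewrite rootE !hornerE q_eval scale0r subr0 det1 subrr.
exists (- r.[b]).
have /(congr1 (fun p : {poly A} => p.[b])) := q_fact.
by rewrite !hornerE q_eval subr0 [RHS]mulrC mulrN opprK => <-; rewrite subrKC.
Qed.

(** Nakayama's lemma for the module generated by [v]: the hypothesis says that
    [1 - b C] kills the column of the [v i]; multiplying by the adjugate, its
    determinant kills each [v i]. *)
Lemma determinant_trick {A : comNzRingType} {E : lmodType A} {n : nat}
    {v : 'I_n -> E} {b : A} (C : 'M[A]_n) :
    (forall i, v i = b *: \sum_j C i j *: v j) ->
  exists d, forall i, (1 - b * d) *: v i = 0.
Proof.
move=> v_eq; pose M := 1%:M - b *: C.
have Mv0 i : \sum_j M i j *: v j = 0.
  under eq_bigr => j _ do rewrite !mxE scalerBl -scalerA.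
  rewrite sumrB -scaler_sumr -v_eq (bigD1 i) //= eqxx scale1r big1 ?addr0 ?subrr //.
  by move=> j; rewrite eq_sym => /negPf->; rewrite scale0r.
have [d det_eq] := det_sub1_scale b C.
exists d => i; rewrite -det_eq -/M.
have -> : \det M *: v i = \sum_j (\adj M *m M) i j *: v j.
  rewrite mul_adj_mx (bigD1 i) //= mxE eqxx mulr1n big1 ?addr0 //.
  by move=> j; rewrite eq_sym mxE => /negPf->; rewrite mulr0n scale0r.
under eq_bigr => j _ do rewrite mxE scaler_suml.
rewrite exchange_big big1 //= => k _.
by under eq_bigr => j _ do rewrite -scalerA; rewrite -scaler_sumr Mv0 scaler0.
Qed.

Lemma in_ann_scale_set (A : comNzRingType) (E : lmodType A) (a b : A) :
  (b \in ann (scale_set a [set: E])) <-> (forall x : E, b *: (a *: x) = 0).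
Proof.
rewrite in_setE; split=> [b_ann x|ba0].
  have : scale_set b (scale_set a [set: E]) (b *: (a *: x)).
    by exists (a *: x) => //; exists x.
  by rewrite b_ann.
apply/seteqP; split=> [_ [_ [x _ <-] <-]|_ ->]; first by rewrite /= ba0.
by exists (a *: 0); [exists 0|rewrite ba0].
Qed.

Lemma scale_set0P (A : comNzRingType) (E : lmodType A) (a : A) :
  scale_set a [set: E] = [set 0] <-> (forall x : E, a *: x = 0).
Proof.
split=> [aE0 x|a0].
  have : scale_set a [set: E] (a *: x) by exists x.
  by rewrite aE0.
apply/seteqP; split=> [_ [x _ <-]|_ ->]; first by rewrite /= a0.
by exists 0; rewrite // a0.
Qed.

(** If [b] does not annihilate [aE], then [(b a)E] is nonzero, hence equal to
    [aE]; so the generators [a *: e i] of [aE] are [b] times combinations of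
    themselves, as the determinant trick requires. *)
Lemma ann_scale_set_inverse {A : comNzRingType} {E : lmodType A} {a b : A} :
    finitely_generated E -> quasi_second E ->
    scale_set a [set: E] <> [set: E] -> b \notin ann (scale_set a [set: E]) ->
  exists d, 1 - b * d \in ann (scale_set a [set: E]).
Proof.
move=> [n [e e_gen]] E_qs aE_neq b_nann.
have baE_eq : scale_set (b * a) [set: E] = scale_set a [set: E].
  apply: E_qs => // [/scale_set0P ba0|_ [x _ <-]].
    move/negP: b_nann; apply; apply/in_ann_scale_set => x.
    by rewrite scalerA ba0.
  by exists (b *: x); rewrite // scalerA mulrC.
have ex_row i : {c : 'I_n -> A | a *: e i = b *: \sum_j c j *: (a *: e j)}.
  apply: cid; have : scale_set a [set: E] (a *: e i) by exists (e i).
  rewrite -baE_eq => -[x _ <-]; have [c ->] := e_gen x; exists c.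
  rewrite -scalerA; congr (_ *: _); rewrite scaler_sumr; apply: eq_bigr => j _.
  by rewrite !scalerA mulrC.
have [d d_ann] : exists d, forall i, (1 - b * d) *: (a *: e i) = 0.
  apply: (determinant_trick (\matrix_(i, j) sval (ex_row i) j)) => i.
  rewrite {1}(svalP (ex_row i)); congr (_ *: _).
  by apply: eq_bigr => j _; rewrite mxE.
exists d; apply/in_ann_scale_set => x; have [c ->] := e_gen x.
rewrite !scaler_sumr big1 // => i _.
have scaleC (r s : A) (y : E) : r *: (s *: y) = s *: (r *: y).
  by rewrite !scalerA mulrC.
by rewrite (scaleC a) scaleC d_ann scaler0.
Qed.

Theorem proposition8 (A : idomainType) (E : lmodType A) :
  finitely_generated E -> quasi_second E ->
  forall a : A, Wsharp [set: E]%classic a ->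
    maximal_ideal (ann (scale_set a [set: E]%classic)).
Proof.
move=> E_fg E_qs a [aE_neqE aE_neq0]; split.
  split.
  - by apply/in_ann_scale_set => x; rewrite scale0r.
  - apply/negP => /in_ann_scale_set ann1; apply/aE_neq0/scale_set0P => x.
    by rewrite -[LHS]scale1r ann1.
  - move=> r u v /in_ann_scale_set u_ann /in_ann_scale_set v_ann.
    apply/in_ann_scale_set => x.
    by rewrite scalerDl -scalerA u_ann v_ann scaler0 addr0.
move=> J [J0 J1 J_lin] subJ; apply/seteqP; split=> // b /mem_set bJ.
apply/set_mem; case: (boolP (b \in _)) => // b_nann.
have [d d_ann] := ann_scale_set_inverse E_fg E_qs aE_neqE b_nann.
case/negP: J1; rewrite -(subrKC (b * d) 1) [b * d]mulrC.
by apply: J_lin => //; rewrite mulrC; apply/mem_set/subJ/set_mem.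
Qed.
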